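(* Fix real numbers $0 \le \gamma < \delta \le 1$ and a positive integer $r$. For each positive integer $n$ let $X^{(n)}$ be the number of cycles, in a permutation of $[n]$ chosen uniformly at random, whose length lies in the interval $[\gamma n, \delta n]$. Then \[ \lim_{n \to \infty} \mathbb{E}\left( (X^{(n)})_r \right) = \int_{\substack{z_1 + \cdots + z_r \le 1 \\ z_i \in [\gamma, \delta],\ 1 \le i \le r}} \frac{1}{z_1 \cdots z_r} \, dz_1 \cdots dz_r . \]
   Context: $[n]=\{1,\dots,n\}$. $(z)_r = z(z-1)\cdots(z-r+1)$ denotes the $r$th falling factorial, and $\mathbb{E}((X)_r)$ is the $r$th factorial moment of $X$. When $\gamma = 0$ the identity is understood in $[0,\infty]$. *)

(* Defs.v *)
From HB Require Import structures.
From mathcomp Require Import all_boot all_order all_algebra all_fingroup.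
From mathcomp Require Import all_classical all_reals all_analysis.

Set Implicit Arguments.
Unset Strict Implicit.
Unset Printing Implicit Defensive.

Import Order.TTheory GRing.Theory Num.Theory.
Import numFieldNormedType.Exports.

Local Open Scope classical_set_scope.
Local Open Scope ring_scope.

Definition num_cycles_between (R : realType) (n : nat) (a b : R)
    (s : {perm 'I_n}) : nat :=
  #|[set c in porbits s | a <= #|c|%:R <= b]|%SET.

(* Expectation of f(w) for w uniform on a (nonempty) finite type. *)
Definition unif_expectation (R : realType) (T : finType) (f : T -> R) : R :=
  (\sum_(w : T) f w) / #|T|%:R.

Definition cons_tuple (T : Type) (r : nat) (p : r.-tuple T * T) :
  r.+1.-tuple T := [tuple of p.2 :: p.1].

Lemma measurable_cons_tuple d (T : measurableType d) (r : nat) :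
  measurable_fun [set: r.-tuple T * T] (@cons_tuple T r).
Proof. exact: measurable_cons. Qed.

(* Lebesgue measure on R^r, realised on r-tuples equipped with the product
   sigma-algebra. *)
Fixpoint lebesgue_tuple (R : realType) (r : nat) :
    set (r.-tuple (measurableTypeR R)) -> \bar R :=
  match r with
  | 0 => \d_([tuple] : 0.-tuple (measurableTypeR R))
  | r'.+1 => pushforward (lebesgue_tuple (r := r') \x lebesgue_measure)%E
               (@cons_tuple (measurableTypeR R) r')
  end.
Arguments lebesgue_tuple : clear implicits.

Lemma lebesgue_tuple_is_measure (R : realType) (r : nat) :
  {m : {measure set (r.-tuple (measurableTypeR R)) -> \bar R} |
    lebesgue_tuple R r = m}.
Proof.
elim: r => [|r [m mE]] /=; first by exists \d_[tuple].
rewrite mE.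
unshelve (eexists (pushforward (m \x lebesgue_measure)%E
  (@cons_tuple (measurableTypeR R) r))) => //.
exact: measurable_cons_tuple.
Qed.

Section lebesgue_tuple_measure.
Context (R : realType) (r : nat).
Local Open Scope ereal_scope.

Let mu0 : lebesgue_tuple R r set0 = 0.
Proof. by have [m ->] := lebesgue_tuple_is_measure R r; exact: measure0. Qed.

Let mu_ge0 A : 0 <= lebesgue_tuple R r A.
Proof. by have [m ->] := lebesgue_tuple_is_measure R r; exact: measure_ge0. Qed.

Let mu_sigma_additive : semi_sigma_additive (lebesgue_tuple R r).
Proof.
have [m ->] := lebesgue_tuple_is_measure R r.
exact: measure_semi_sigma_additive.
Qed.

HB.instance Definition _ := isMeasure.Build _ _ _
  (lebesgue_tuple R r) mu0 mu_ge0 mu_sigma_additive.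

End lebesgue_tuple_measure.

Lemma lebesgue_tuple_box (R : realType) (r : nat)
    (A : 'I_r -> set (measurableTypeR R)) :
  (forall i, measurable (A i)) ->
  (lebesgue_tuple R r [set z | forall i, A i (tnth z i)] =
   \prod_(i < r) lebesgue_measure (A i))%E.
Proof.
elim: r A => [|r IH] A mA.
  rewrite big_ord0 /= diracE mem_set//= => -[] //.
rewrite big_ord_recl /= /pushforward.
rewrite (_ : _ @^-1` _ =
  [set z | forall i, A (lift ord0 i) (tnth z i)] `*` A ord0); last first.
  apply/seteqP; split=> [[z x] /= h|[z x] /= [h h0] i].
    by split=> [i|]; [have := h (lift ord0 i); rewrite tnthS|exact: (h ord0)].
  by have [j ->|->] := unliftP ord0 i; rewrite ?tnthS//; exact: h.
rewrite product_measure1E//; first by rewrite muleC -IH.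
rewrite (_ : mkset _ = \bigcap_(i in [set: 'I_r])
    ((fun z : r.-tuple (measurableTypeR R) => tnth z i) @^-1` A (lift ord0 i))).
  apply: fin_bigcap_measurable => // i _.
  by rewrite -[X in measurable X]setTI; exact: measurable_tnth.
by apply/seteqP; split=> [z h i _|z h i]; exact: h.
Qed.

(* Main.v *)
Require Import Defs.
From mathcomp Require Import all_boot all_order all_algebra all_fingroup.
From mathcomp Require Import all_classical all_reals all_analysis.
From mathcomp Require Import measurable_realfun.

Import Order.TTheory GRing.Theory Num.Theory.
Import numFieldNormedType.Exports.
Local Open Scope classical_set_scope.
Local Open Scope ring_scope.

(** The factorial moment is an exact Riemann sum for the integral.

    For a set [w] of allowed lengths, [E((X)_r)] counts ordered [r]-tuples of
    distinct cycles with lengths in [w]. Marking a starting point in a cycle of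
    length [l] turns it into a word of [l] distinct letters, and each cycle
    comes from [l] words; once the words of all [r] cycles are fixed, with
    [L] letters in total, [(n - L)!] permutations contain them, and there are
    [n!/(n - L)!] ways of choosing the letters. Everything cancels except the
    factors [1/l] that compensate the marking, and
      [E((X)_r) = sum of 1/(l_1 ... l_r)]
    over the lengths in [w] with [l_1 + ... + l_r <= n]. This is proved in
    [sum_ffact_cycles_off], by induction on [r]: one extracts one cycle at a
    time, keeping track of the set [W] of points on which the permutation is
    already prescribed.

    With lengths allowed between [gamma n] and [delta n], the sum is the
    integral of the function [step n] that takes the constant value
    [prod_i n / l_i] on the cube [(l_i - 1)/n < z_i <= l_i/n] for each
    admissible [(l_1, ..., l_r)] and vanishes elsewhere ([integral_step]). Away
    from the hyperplanes [z_i = gamma], [z_i = delta] and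
    [z_1 + ... + z_r = 1], which are null sets, [step n] converges pointwise to
    the integrand extended by zero ([step_cvg_ae]).

    The integrals converge too, for one of two reasons. If [gamma > 0], then
    [step n] is supported in the unit cube and at most [gamma^-r], and dominated
    convergence applies. If [gamma = 0], the integral may be infinite, but
    sampling at the upper corner of each cube makes [step n] at most the
    integrand extended by zero, so that its integrals are at most the claimed
    limit. Fatou's lemma gives the converse bound, and the argument does not
    distinguish finite from infinite values. *)

Set Implicit Arguments.
Unset Strict Implicit.

(** * Factorial moments of cycle counts *)

Section CycleMoments.
Local Close Scope classical_set_scope.
Import fintype boot.finset.
Variable T : finType.
Implicit Types (s sg : {perm T}) (W : {set T}) (w : pred nat) (v : seq T).

Definition agree sg W : {set {perm T}} :=
  [set s : {perm T} | [forall x in W, s x == sg x]].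

Definition cycles_off w s W : {set {set T}} :=
  [set c in porbits s | (c \subset ~: W) && w #|c|].

(** For a repetition-free word [v], the cycle [(v_0 v_1 ... v_k)]. Removing
    duplicates only serves to make the definition total. *)
Definition next_perm v : {perm T} := perm (can_inj (prev_next (undup_uniq v))).

Lemma next_permE v : uniq v -> next_perm v =1 next v.
Proof. by move=> uv x; rewrite permE undup_id. Qed.

Lemma agreeP sg W s : reflect {in W, s =1 sg} (s \in agree sg W).
Proof. by rewrite inE; apply: (iffP forall_inP) => h x /h /eqP. Qed.

Lemma subn_cards W : (#|T| - #|W|)%N = #|~: W|.
Proof. by rewrite [RHS]cardsCs setCK. Qed.

(** Multiplying by [sg^-1] turns the constraint into fixing [W] pointwise. *)
Lemma card_agree sg W : #|agree sg W| = (#|T| - #|W|)`!.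
Proof.
rewrite subn_cards -card_perm.
rewrite (_ : agree sg W = [set (s * sg)%g | s in perm_on (~: W)]).
  by rewrite card_imset//; exact: mulIg.
apply/setP => s; apply/agreeP/imsetP => [sW|[t tW ->] x xW]; last first.
  by rewrite permM (out_perm tW)// inE negbK.
exists (s * sg^-1)%g; last by rewrite mulgKV.
apply/subsetP => x; rewrite !inE permM; apply: contra => /sW ->.
by rewrite permK.
Qed.

Lemma traject_fcycle s x l (v : l.+1.-tuple T) :
  fcycle s v -> thead v = x -> val v = traject s x l.+1.
Proof.
case: (tupleP v) => y t /=; rewrite theadE => + yx.
rewrite yx rcons_path => /andP[/fpathE]; rewrite size_tuple => <- //.
Qed.

Lemma porbit_fcycle s x v : uniq v -> fcycle s v -> x \in v ->
  porbit s x = [set y in v]%SET.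
Proof.
move=> uv cv xv.
have sv y : y \in v -> s y \in v.
  by move=> yv; rewrite (eqP (next_cycle cv yv)) mem_next.
have sub : porbit s x \subset [set y in v].
  apply/subsetP => y /porbitP[i ->]; rewrite inE.
  by elim: i => [|i ih]; rewrite ?expg0 ?perm1// expgSr permM sv.
case/rot_to: (xv) => i v' rotv.
have cv' : fcycle s (x :: v') by rewrite -rotv rot_cycle.
apply/eqP; rewrite eqEsubset sub; apply/subsetP => y.
rewrite inE -(mem_rot i) rotv.
have -> : x :: v' = traject s x (size v').+1.
  by move: cv' => /=; rewrite rcons_path => /andP[/fpathE <-].
by move=> /trajectP[k _ ->]; rewrite -permX mem_porbit.
Qed.

(** A word read along a cycle of [s] is determined by its first letter, and
    every point of the cycle can be that letter. *)
Lemma card_cyclic_words s W l :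
  #|[set v : l.+1.-tuple T | [&& all (mem (~: W)) v, uniq v & fcycle s v]]| =
  #|[set x | (porbit s x \subset ~: W) && (#|porbit s x| == l.+1)]|.
Proof.
rewrite -(card_in_imset (f := fun v : l.+1.-tuple T => thead v)); last first.
  move=> u v; rewrite !inE => /and3P[_ _ cu] /and3P[_ _ cv] uv.
  by apply/val_inj; rewrite (traject_fcycle cu uv) (traject_fcycle cv erefl).
apply: eq_card => x; rewrite inE; apply/imsetP/andP => [[v]|[xW /eqP xl]].
  rewrite inE => /and3P[/allP vW uv cv] ->.
  have -> := porbit_fcycle uv cv (mem_tnth _ _).
  split; first by apply/subsetP => y; rewrite inE => /vW.
  by rewrite cardsE (card_uniqP uv) size_tuple.
have sz : size (traject s x l.+1) == l.+1 by rewrite size_traject.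
exists (Tuple sz); last by [].
rewrite inE; apply/and3P; split.
- by apply/allP => y; rewrite -[tval _]/(traject s x l.+1) -xl -porbit_traject;
    apply: (subsetP xW).
- by rewrite -[tval _]/(traject s x l.+1) -xl uniq_traject_porbit.
have := iter_porbit s x; rewrite xl /= rcons_path fpath_traject /=.
by rewrite last_traject => ->.
Qed.

(** Each cycle of length [l] is counted through its [l] points, each with
    weight [1/l]; the points are then grouped by the length of their cycle. *)
Lemma card_cycles_off (R : numFieldType) w s W :
  #|cycles_off w s W|%:R = \sum_(l < #|T| - #|W|) (w l.+1)%:R / l.+1%:R *
    #|[set x | (porbit s x \subset ~: W) && (#|porbit s x| == l.+1)]|%:R :> R.
Proof.
pose P x := (porbit s x \subset ~: W) && w #|porbit s x|.
have -> : #|cycles_off w s W|%:R = \sum_(x | P x) #|porbit s x|%:R^-1 :> R.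
  rewrite (partition_big (porbit s) (mem (cycles_off w s W))) /=; last first.
    by move=> x Px; rewrite inE imset_f.
  rewrite -sum1_card natr_sum; apply: eq_bigr => c.
  rewrite inE => /andP[/imsetP[x _ ->]] Px.
  rewrite (eq_big (fun y => y \in porbit s x)
    (fun=> #|porbit s x|%:R^-1)); first last.
  - by move=> y /andP[_ /eqP ->].
  - move=> y; rewrite -eq_porbit_mem /P; case: eqP => [->|_];
      last by rewrite andbF.
    by rewrite andbT; apply/idP.
  by rewrite sumr_const -[RHS]mulr_natr mulVf// pnatr_eq0 card_porbit_neq0.
transitivity (\sum_(l < #|T| - #|W|)
    \sum_(x | (porbit s x \subset ~: W) && (#|porbit s x| == l.+1))
      ((w l.+1)%:R / l.+1%:R : R)); last first.
  by apply: eq_bigr => l _; rewrite sumr_const -[LHS]mulr_natr cardsE.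
rewrite (exchange_big_dep (fun x => porbit s x \subset ~: W)) /=; last first.
  by move=> l x _ /andP[].
rewrite big_mkcond [RHS]big_mkcond; apply: eq_bigr => x _; rewrite /P.
case: ifPn => [/andP[xW wx]|]; last first.
  case: ifPn => //= xW; rewrite xW /= => nwx; rewrite big1// => l /eqP xl.
  by rewrite -xl (negbTE nwx) mul0r.
have x0 : (0 < #|porbit s x|)%N by rewrite lt0n card_porbit_neq0.
have lx : (#|porbit s x|.-1 < #|T| - #|W|)%N.
  by rewrite prednK// subn_cards subset_leq_card.
rewrite xW /= (bigD1 (Ordinal lx)) /=; last by rewrite prednK.
rewrite big1 ?addr0; last first.
  move=> l /andP[/eqP e /eqP ne]; case: ne; apply/val_inj => /=.
  by rewrite e.
by rewrite prednK// wx mul1r.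
Qed.

Section StepWord.
Variables (sg : {perm T}) (W : {set T}) (v : seq T).
Hypotheses (sgW : perm_on W sg) (uv : uniq v) (vW : all (mem (~: W)) v).

(** The next three lemmas extract one cycle. A permutation prescribed by [sg]
    on [W] that moreover runs through [v] cyclically is one prescribed by
    [sg * next_perm v] on [W] and [v]; the counting of the remaining cycles then
    loses exactly the cycle [v]. *)
Lemma perm_on_next : perm_on (W :|: [set x in v]) (sg * next_perm v)%g.
Proof.
apply: perm_onM; apply/subsetP => x; rewrite !inE => h.
  by rewrite (subsetP sgW).
apply/orP; right; apply: contraR h => xv.
apply/eqP; rewrite next_permE//.
by rewrite next_nth (negbTE xv).
Qed.

Lemma agree_next s : (s \in agree sg W) && fcycle s v =
  (s \in agree (sg * next_perm v)%g (W :|: [set x in v])).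
Proof.
have sgv x : x \in v -> sg x = x.
  by move=> /(allP vW) xW; apply: (out_perm sgW); move: xW; rewrite !inE.
have vsg x : x \in W -> (sg x \in v) = false.
  rewrite -(perm_closed x sgW) => h; apply/negP => /(allP vW).
  by rewrite !inE h.
apply/andP/agreeP => [[/agreeP sW cv] x|h].
  rewrite inE permM next_permE// => /orP[xW|]; last first.
    by rewrite inE => xv; rewrite sgv// (eqP (next_cycle cv xv)).
  by rewrite sW// next_nth vsg.
split.
  apply/agreeP => x xW; rewrite h ?inE ?xW// permM next_permE//.
  by rewrite next_nth vsg.
apply: cycle_from_next => // x xv /=.
by rewrite h ?inE ?xv ?orbT// permM next_permE// sgv.
Qed.

Lemma cycles_off_next w s : w (size v) -> (0 < size v)%N -> fcycle s v ->
  #|cycles_off w s (W :|: [set x in v])| = #|cycles_off w s W|.-1.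
Proof.
move=> wv v0 cv; case: v v0 cv uv vW wv => // x v' _ cv uv' vW' wv.
set V := [set y in x :: v']%SET.
have xV : porbit s x = V by apply: porbit_fcycle => //; exact: mem_head.
have V_in : V \in cycles_off w s W.
  rewrite inE cardsE (card_uniqP uv') wv -xV imset_f//= xV andbT.
  by apply/subsetP => y; rewrite inE => /(allP vW').
rewrite [in RHS](cardsD1 V) V_in /=; apply: eq_card => c.
rewrite !inE; case cs: (c \in porbits s) => /=; last by rewrite andbF.
case: (w _); rewrite ?andbF// !andbT setCU subsetI andbC; congr andb.
case/imsetP: cs => y _ ->.
apply/idP/idP => [|yV].
  apply: contraTneq => ->; apply/subsetPn; exists x;
    first by rewrite inE mem_head.
  by rewrite !inE eqxx.
apply/subsetP => z; rewrite -eq_porbit_mem => /eqP zy.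
rewrite in_setC; apply: contra yV.
by rewrite -zy -[X in _ == X]xV eq_porbit_mem xV.
Qed.

End StepWord.

(** The sum of [prod_i w(l_i) / l_i] over the [r]-tuples of positive integers
    with [l_1 + ... + l_r <= m]; the recursion isolates the first length, which
    is the way the moments are computed below. *)
Fixpoint composition_sum (R : numFieldType) w (r m : nat) : R :=
  if r is r'.+1 then
    \sum_(l < m) (w l.+1)%:R / l.+1%:R * composition_sum R w r' (m - l.+1)
  else 1.

(** The induction step writes [(X)_(r+1) = X (X - 1)_r], replaces the factor
    [X] by a weighted count of words [v], and exchanges the sums. For given [v]
    the inner sum is an instance of the induction hypothesis with the larger set
    [W :|: v], which depends only on the length of [v]; the number of
    words times [(m - l)!] is [m!], where [m = #|T| - #|W|]. *)
Lemma sum_ffact_cycles_off (R : numFieldType) w r sg W : perm_on W sg ->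
  \sum_(s in agree sg W) (#|cycles_off w s W| ^_ r)%:R =
  (#|T| - #|W|)`!%:R * composition_sum R w r (#|T| - #|W|).
Proof.
elim: r sg W => [|r IH] sg W sgW /=.
  under eq_bigr do rewrite ffactn0.
  by rewrite sumr_const -mulr_natr mul1r card_agree mulr1.
under eq_bigr do rewrite ffactnS natrM card_cycles_off mulr_suml.
rewrite exchange_big mulr_sumr; apply: eq_bigr => l _ /=.
have [wl|] := boolP (w l.+1); last first.
  by rewrite !mul0r mulr0 big1// => s _; rewrite !mul0r.
move: (true%:R / _) => c.
under eq_bigr do rewrite -card_cyclic_words -mulrA.
rewrite -mulr_sumr mulrCA; congr (_ * _).
under eq_bigr do rewrite -sum1_card natr_sum mulr_suml.
rewrite (exchange_big_dep (mem [set v : l.+1.-tuple T |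
   all (mem (~: W)) v & uniq v])) /=; last first.
  by move=> s v _; rewrite !inE => /and3P[-> ->].
transitivity (\sum_(v in [set v : l.+1.-tuple T |
   all (mem (~: W)) v & uniq v]) ((#|T| - #|W| - l.+1)`!%:R *
   composition_sum R w r (#|T| - #|W| - l.+1))).
  apply: eq_bigr => v; rewrite inE => /andP[vW uv].
  have cv : #|W :|: [set x in v]| = (#|W| + l.+1)%N.
    rewrite cardsU cardsE (card_uniqP uv) size_tuple.
    rewrite (_ : _ :&: _ = set0) ?cards0 ?subn0//.
    apply/setP => x; rewrite !inE; apply/negP => /andP[xW /(allP vW)].
    by rewrite !inE xW.
  rewrite -subnDA -cv -(IH _ _ (perm_on_next sgW uv)).
  apply: eq_big => [s|s].
    by rewrite -(agree_next sgW uv vW) [v \in _]inE vW uv.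
  rewrite [v \in _]inE vW uv /= => /andP[_ cs].
  by rewrite mul1r cycles_off_next// ?size_tuple.
rewrite sumr_const card_uniq_tuples -[LHS]mulr_natl mulrA -natrM.
by rewrite -subn_cards ffact_fact.
Qed.

Lemma sum_ffact_cycles (R : numFieldType) w r :
  \sum_(s : {perm T}) (#|[set c in porbits s | w #|c| ]| ^_ r)%:R =
  #|{perm T}|%:R * composition_sum R w r #|T|.
Proof.
have := sum_ffact_cycles_off R w r (perm_on1 set0).
rewrite cards0 subn0 => h.
rewrite -[#|{perm T}|]cardsT.
have -> : [set: {perm T}] = agree 1 set0.
  by apply/setP => s; rewrite !inE; apply/esym/forall_inP => x; rewrite inE.
rewrite card_agree cards0 subn0 -h; apply: eq_big => [s|s _].
  by rewrite inE; apply/esym/forall_inP => x; rewrite inE.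
congr (_ ^_ _)%:R; apply: eq_card => c; rewrite !inE setC0 subsetT.
by [].
Qed.

End CycleMoments.

(** * Null hyperplanes *)

Section LebesgueTuple.
Variables (R : realType) (r : nat).
Local Notation mR := (measurableTypeR R).
Local Notation mu := (lebesgue_tuple R r).

Lemma measurable_coord (i : 'I_r) :
  measurable_fun [set: r.-tuple mR] (fun z => tnth z i : R).
Proof. exact: measurable_tnth. Qed.

Lemma measurable_box (A : 'I_r -> set mR) : (forall i, measurable (A i)) ->
  measurable [set z : r.-tuple mR | forall i, A i (tnth z i)].
Proof.
move=> mA; rewrite (_ : mkset _ = \bigcap_(i in [set: 'I_r])
    ((fun z : r.-tuple mR => tnth z i) @^-1` A i)).
  apply: fin_bigcap_measurable => // i _.
  by rewrite -[X in measurable X]setTI; apply: measurable_tnth.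
by apply/seteqP; split=> [z h i _|z h i]; exact: h.
Qed.

Lemma ae_coord_neq (i : 'I_r) (c : R) : {ae mu, forall z, (tnth z i : R) != c}.
Proof.
pose A j : set mR := if j == i then [set c] else setT.
have mA j : measurable (A j) by rewrite /A; case: ifP.
exists [set z | forall j, A j (tnth z j)]; split; first exact: measurable_box.
  transitivity (\prod_(j < r) lebesgue_measure (A j))%E.
    exact: lebesgue_tuple_box.
  by rewrite (bigD1 i)//= /A eqxx lebesgue_measure_set1 mul0e.
move=> z /= /negP; rewrite negbK => /eqP zc j.
by rewrite /A; case: eqP => // ->.
Qed.

End LebesgueTuple.

(** Fubini: once the other coordinates are fixed, the equation leaves a single
    value for the first one. *)
Lemma ae_sum_neq (R : realType) (r : nat) (c : R) : (0 < r)%N ->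
  {ae lebesgue_tuple R r, forall z, \sum_(i < r) (tnth z i : R) != c}.
Proof.
case: r => // r _.
pose N := [set z : r.+1.-tuple (measurableTypeR R) |
  \sum_(i < r.+1) (tnth z i : R) = c].
exists N; split; last by move=> z /= /negP; rewrite negbK => /eqP.
- rewrite (_ : N = (fun z => \sum_(i < r.+1) (tnth z i : R)) @^-1` [set c])//.
  rewrite -[X in measurable X]setTI.
  by apply: measurable_sum => // i; exact: measurable_coord.
- rewrite /= /pushforward /product_measure1 integral0_eq// => z _ /=.
  rewrite (_ : xsection _ _ = [set c - \sum_(i < r) (tnth z i : R)]).
    exact: lebesgue_measure_set1.
  have sumE (x : R) : \sum_(i < r.+1) (tnth (Defs.cons_tuple (z, x)) i : R) =
      x + \sum_(i < r) (tnth z i : R).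
    rewrite big_ord_recl; congr (_ + _); apply: eq_bigr => i _.
    exact: tnthS.
  apply/seteqP; split => x; rewrite /xsection /= inE /N /= sumE.
    by move=> <-; rewrite addrK.
  by move=> ->; rewrite subrK.
Qed.

(** * The moment as the integral of a step function *)

Lemma big_cons_tuple (S : nmodType) n r (P : pred (r.+1.-tuple 'I_n))
    (F : r.+1.-tuple 'I_n -> S) :
  \sum_(t | P t) F t =
  \sum_(x < n) \sum_(t : r.-tuple 'I_n | P [tuple of x :: t])
    F [tuple of x :: t].
Proof.
rewrite pair_big_dep /=.
rewrite (reindex (fun p : 'I_n * r.-tuple 'I_n => [tuple of p.1 :: p.2]))//.
exists (fun t => (thead t, [tuple of behead t])) => [[x t] _ | t _] /=.
  by congr pair; apply/val_inj.
by rewrite -tuple_eta.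
Qed.

Lemma composition_sumE (R : numFieldType) (w : pred nat) (n r m : nat) :
  (m <= n)%N -> composition_sum R w r m =
  \sum_(t : r.-tuple 'I_n | (\sum_(i < r) (tnth t i).+1 <= m)%N)
    \prod_(i < r) ((w (tnth t i).+1)%:R / (tnth t i).+1%:R).
Proof.
elim: r m => [|r IH] m mn /=.
  rewrite (eq_bigl xpredT); last by move=> t; rewrite big_ord0.
  rewrite (eq_bigr (fun=> 1)); last by move=> t _; rewrite big_ord0.
  by rewrite sumr_const card_tuple expn0.
have tS (x : 'I_n) (t : r.-tuple 'I_n) :
    (\sum_(i < r.+1) (tnth [tuple of x :: t] i).+1 =
     x.+1 + \sum_(i < r) (tnth t i).+1)%N.
  rewrite big_ord_recl; congr (_ + _)%N; apply: eq_bigr => i _.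
  by rewrite tnthS.
rewrite big_cons_tuple.
rewrite (big_ord_widen n (fun l => (w l.+1)%:R / l.+1%:R *
  composition_sum R w r (m - l.+1)))//.
rewrite big_mkcond; apply: eq_bigr => x _.
under eq_bigl do rewrite tS.
case: ifPn => [xm|]; last first.
  rewrite -leqNgt => mx; rewrite big_pred0// => t.
  by rewrite leqNgt addSn ltnS (leq_trans mx (leq_addr _ _)).
rewrite (IH _ (leq_trans (leq_subr _ _) mn)) mulr_sumr.
apply: eq_big => [t|t _]; first by rewrite leq_subRL.
rewrite [RHS]big_ord_recl; congr (_ * _).
by apply: eq_bigr => i _; rewrite tnthS.
Qed.

(** [k.+1] is the least natural number that is at least [x]; it differs from one
    plus the integer part when [x] is an integer. *)
Lemma ex_unit_cell (R : realType) (x : R) : 0 < x ->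
  exists k : nat, k%:R < x <= k.+1%:R.
Proof.
move=> x0; have ex : exists m : nat, x <= m%:R.
  by exists (Num.bound x); apply: ltW; rewrite archi_boundP// ltW.
case: (ex_minnP ex) => [[|k] xk min]; first by move: x0; rewrite ltNge xk.
exists k; rewrite xk andbT ltNge; apply/negP => /min.
by rewrite ltnn.
Qed.

Section StepFunction.
Variables (R : realType) (r : nat) (gamma delta : R).
Local Notation mR := (measurableTypeR R).
Local Notation mu := (lebesgue_tuple R r).

(** The condition is multiplied by [n] so as to make sense for [n = 0] too. The
    index [k] stands for the cycle length [k.+1], which is [n] times the right
    end of the interval; likewise a tuple [t] stands for the lengths
    [(tnth t i).+1]. *)
Definition subcell (n k : nat) : set mR :=
  [set x : R | k%:R < n%:R * x <= k.+1%:R].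

Definition cell n (t : r.-tuple 'I_n) : set (r.-tuple mR) :=
  [set z | forall i, subcell n (tnth t i) (tnth z i)].

Definition admissible n (t : r.-tuple 'I_n) : bool :=
  (\sum_(i < r) (tnth t i).+1 <= n)%N &&
  [forall i, gamma * n%:R <= (tnth t i).+1%:R <= delta * n%:R].

Definition weight n (t : r.-tuple 'I_n) : R :=
  \prod_(i < r) (n%:R / (tnth t i).+1%:R).

Definition step n (z : r.-tuple mR) : R :=
  \sum_(t : r.-tuple 'I_n | admissible t) weight t * \1_(cell t) z.

Lemma subcellE n k : (0 < n)%N ->
  subcell n k = [set` `](k%:R / n%:R : R), (k.+1%:R / n%:R)]].
Proof.
move=> n0; apply/seteqP; split => x /=;
  by rewrite in_itv /= ltr_pdivrMr ?ler_pdivlMr ?ltr0n// [x * _]mulrC.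
Qed.

Lemma measurable_cell n (t : r.-tuple 'I_n) : measurable (cell t).
Proof.
apply: (measurable_box (A := fun i => subcell n (tnth t i))) => i;
case: n t => [t|n t]; first by case: (tnth t i).
by rewrite subcellE//; exact: measurable_itv.
Qed.

Lemma lebesgue_cell n (t : r.-tuple 'I_n) : (0 < n)%N ->
  mu (cell t) = (n%:R^-1 ^+ r)%:E.
Proof.
move=> n0.
transitivity (\prod_(i < r) lebesgue_measure (subcell n (tnth t i)))%E.
  apply: (lebesgue_tuple_box (A := fun i => subcell n (tnth t i))) => i.
  by rewrite subcellE//; exact: measurable_itv.
transitivity (\prod_(i < r) (n%:R^-1 : R)%:E)%E.
  apply: eq_bigr => i _; rewrite subcellE// lebesgue_measure_itv /=.
  rewrite lte_fin ltr_pM2r ?invr_gt0 ?ltr0n// ltr_nat ltnSn.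
  by rewrite -EFinB -mulrBl -natrB// subSnn mul1r.
by rewrite prodEFin prodr_const card_ord.
Qed.

Lemma weight_ge0 n (t : r.-tuple 'I_n) : 0 <= weight t.
Proof. by apply: prodr_ge0 => i _; rewrite divr_ge0. Qed.

Lemma step_ge0 n z : 0 <= step n z.
Proof. by apply: sumr_ge0 => t _; rewrite mulr_ge0// weight_ge0. Qed.

Lemma measurable_step n : measurable_fun setT (step n).
Proof.
rewrite (_ : step n = fun z => \sum_(t <- [seq t <- index_enum _ |
    admissible t]) weight (n := n) t * \1_(cell t) z); last first.
  by apply/funext => z; rewrite big_filter.
apply: measurable_sum => t; apply: measurable_funM => //.
by apply: measurable_indic; exact: measurable_cell.
Qed.

Lemma integral_step n : (0 < n)%N ->
  (\int[mu]_z (step n z)%:E =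
   (composition_sum R (fun k => gamma * n%:R <= k%:R <= delta * n%:R)
      r n)%:E)%E.
Proof.
move=> n0.
transitivity (\int[mu]_z (\sum_(t <- [seq t <- index_enum _ |
    admissible t]) ((weight (n := n) t)%:E * (\1_(cell t) z)%:E)))%E.
  by apply: eq_integral => z _; rewrite big_filter -sumEFin.
rewrite ge0_integral_sum//; first last.
- by move=> t z _; rewrite mule_ge0 ?lee_fin ?weight_ge0.
- move=> t; apply: emeasurable_funM => //.
  apply/measurable_EFinP.
  by apply: measurable_indic; exact: measurable_cell.
rewrite big_filter.
rewrite (composition_sumE _ _ _ (leqnn n)) -sumEFin.
rewrite [RHS](bigID (fun t : r.-tuple 'I_n =>
  [forall i, gamma * n%:R <= (tnth t i).+1%:R <= delta * n%:R])) /=.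
rewrite [X in (_ + X)%E]big1 ?adde0; last first.
  move=> t /andP[_]; rewrite negb_forall => /existsP[i /negbTE h].
  by rewrite (bigD1 i)//= h mul0r mul0r.
apply: eq_bigr => t /andP[_ /forallP ht].
rewrite ge0_integralZl_EFin ?weight_ge0//; first last.
  apply/measurable_EFinP.
  by apply: measurable_indic; exact: measurable_cell.
rewrite integral_indic//; last exact: measurable_cell.
rewrite setIT [X in (_ * X)%E]lebesgue_cell// -EFinM; congr EFin.
rewrite -[X in _ ^+ X]card_ord -prodr_const -big_split /=.
apply: eq_bigr => i _; rewrite ht.
by rewrite mulrAC mulfV// pnatr_eq0 -lt0n.
Qed.

Lemma cell_inj n (t u : r.-tuple 'I_n) z : cell t z -> cell u z -> t = u.
Proof.
move=> tz uz; apply: eq_from_tnth => i; apply/val_inj/eqP.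
have /andP[t1 t2] := tz i; have /andP[u1 u2] := uz i.
by rewrite eqn_leq -ltnS -(ltr_nat R) (lt_le_trans t1 u2) -ltnS
  -(ltr_nat R) (lt_le_trans u1 t2).
Qed.

Lemma stepE n (t : r.-tuple 'I_n) z : admissible t -> cell t z ->
  step n z = weight t.
Proof.
move=> at_ tz; rewrite /step (bigD1 t)//= indicE mem_set// mulr1.
rewrite big1 ?addr0// => u /andP[_ ut]; rewrite indicE memNset ?mulr0//.
by move=> uz; rewrite (cell_inj tz uz) eqxx in ut.
Qed.

(** As the cells are disjoint, at most one term of [step n z] is nonzero. *)
Lemma stepP n z : step n z = 0 \/
  exists t : r.-tuple 'I_n, [/\ admissible t, cell t z & step n z = weight t].
Proof.
have [[t [at_ tz]]|no] := pselect (exists t : r.-tuple 'I_n,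
  admissible t /\ cell t z).
  by right; exists t; split => //; exact: stepE.
left; apply: big1 => t at_; rewrite indicE memNset ?mulr0// => tz.
by apply: no; exists t.
Qed.

End StepFunction.

(** * Pointwise convergence of the step functions *)

Lemma cvg_invn (R : realType) : (n%:R^-1 : R) @[n --> \oo] --> (0 : R).
Proof.
apply/gtr0_cvgV0; last exact: cvgr_idn.
by near=> n; rewrite ltr0n; near: n; exists 1%N.
Unshelve. all: by end_near. Qed.

(** Stated for extended reals so as to cover an infinite limit. *)
Lemma sandwich_cvg_einf (R : realType) (u : (\bar R)^nat) (l : \bar R) :
  (forall n, u n <= l)%E -> (l <= limn_einf u)%E -> u @ \oo --> l.
Proof.
move=> ul lu.
have : (-%E \o u) @ \oo --> (- l)%E.
  by apply: limn_esup_le_cvg => [|n]; rewrite ?limn_esupN leeN2.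
move/cvgeN; rewrite oppeK; under eq_fun do rewrite /= oppeK.
by [].
Qed.

Section Region.
Variables (R : realType) (r : nat) (gamma delta : R).
Hypotheses (hgamma : 0 <= gamma) (hdelta : delta <= 1).
Local Notation mR := (measurableTypeR R).
Local Notation mu := (lebesgue_tuple R r).
Local Notation step := (step gamma delta).

Definition region : set (r.-tuple mR) :=
  [set z | (\sum_(i < r) (tnth z i : R) <= 1)%R /\
           forall i, (gamma <= (tnth z i : R) <= delta)%R].

Definition integrand (z : r.-tuple mR) : \bar R :=
  ((\prod_(i < r) (tnth z i : R))^-1)%:E.

Lemma measurable_region : measurable region.
Proof.
rewrite (_ : region =
  (fun z => \sum_(i < r) (tnth z i : R)) @^-1` `]-oo, 1] `&`
  [set z | forall i, [set x : mR | gamma <= x <= delta] (tnth z i)]);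
  last first.
  by apply/seteqP; split => z; rewrite /region /= in_itv.
apply: measurableI; last first.
  apply: (measurable_box (A := fun=> [set x : mR | gamma <= x <= delta])) => i.
  rewrite (_ : mkset _ = [set` `[gamma, delta]]); first exact: measurable_itv.
  by apply/seteqP; split => x; rewrite /= in_itv.
rewrite -[X in measurable X]setTI.
by apply: measurable_sum => // i; exact: measurable_coord.
Qed.

Lemma coord_ge0 z i : region z -> 0 <= (tnth z i : R).
Proof. by move=> [_ /(_ i) /andP[+ _]]; exact: le_trans. Qed.

Lemma restrict_integrand_ge0 z : (0 <= (integrand \_ region) z)%E.
Proof.
rewrite patchE; case: ifPn => // /set_mem zr.
by rewrite lee_fin invr_ge0 prodr_ge0// => i _; exact: coord_ge0.
Qed.

(** On the region the coordinates are nonnegative, so that the inverse coincides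
    with the real power of exponent [-1], a measurable function, also at [0]. *)
Lemma measurable_integrand : measurable_fun setT (integrand \_ region).
Proof.
apply/(measurable_restrictT _ measurable_region).
apply: (eq_measurable_fun
    (fun z => ((\prod_(i < r) (tnth z i : R)) `^ (-1))%:E)).
  move=> z /set_mem zr; rewrite powR_inv1//.
  by apply: prodr_ge0 => i _; exact: coord_ge0.
apply: measurable_funTS; apply/measurable_EFinP.
apply: (measurableT_comp (measurable_powR _)).
by apply: measurable_prod => i _; exact: measurable_coord.
Qed.

Lemma cell_ge n (t : r.-tuple 'I_n) (z : r.-tuple mR) i : cell t z ->
  n%:R * (tnth z i : R) <= (tnth t i).+1%:R.
Proof. by move=> /(_ i) /andP[]. Qed.

Lemma cell_lt n (t : r.-tuple 'I_n) (z : r.-tuple mR) i : cell t z ->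
  (tnth t i).+1%:R < n%:R * (tnth z i : R) + 1.
Proof. by move=> /(_ i) /andP[h _]; rewrite -natr1 ltrD2r. Qed.

Lemma cell_pos n (t : r.-tuple 'I_n) (z : r.-tuple mR) i : cell t z ->
  0 < (tnth z i : R).
Proof.
move=> /(_ i) /andP[h _]; have := le_lt_trans (ler0n _ _) h.
by case: n t h => [|n] t h; [rewrite mul0r ltxx|rewrite pmulr_rgt0].
Qed.

Lemma tuple_ord_gt0 n (t : r.-tuple 'I_n) : (0 < r)%N -> (0 < n)%N.
Proof. by case: n t => // t r0; case: (tnth t (Ordinal r0)). Qed.

(** A cell is sampled at its upper corner, where the integrand is least;
    this makes [step n] a lower approximation. *)
Lemma weight_le n (t : r.-tuple 'I_n) (z : r.-tuple mR) : cell t z ->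
  weight R t <= (\prod_(i < r) (tnth z i : R))^-1.
Proof.
move=> tz; rewrite -prodfV; apply: ler_prod => i _.
have z0 := cell_pos i tz.
rewrite divr_ge0//= ler_pdivrMr// mulrC ler_pdivlMr//.
exact: cell_ge.
Qed.

Lemma le_weight n (t : r.-tuple 'I_n) (z : r.-tuple mR) : (0 < n)%N ->
  cell t z -> \prod_(i < r) ((tnth z i : R) + n%:R^-1)^-1 <= weight R t.
Proof.
move=> n0 tz; apply: ler_prod => i _.
have z0 : 0 < (tnth z i : R) + n%:R^-1.
  by rewrite addr_gt0 ?(cell_pos _ tz)// invr_gt0 ltr0n.
rewrite invr_ge0 ltW//= ler_pdivlMr// mulrC ler_pdivrMr//.
rewrite mulrDr mulfV ?pnatr_eq0 -?lt0n//.
by apply/ltW/cell_lt.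
Qed.

Lemma admissible_sum n (t : r.-tuple 'I_n) (z : r.-tuple mR) :
  (0 < n)%N -> admissible gamma delta t -> cell t z ->
  \sum_(i < r) (tnth z i : R) <= 1.
Proof.
move=> n0 /andP[st _] tz.
rewrite -(@ler_pM2l _ n%:R) ?ltr0n// mulr1 mulr_sumr.
apply: (@le_trans _ _ (\sum_(i < r) (tnth t i).+1)%:R); last by rewrite ler_nat.
by rewrite natr_sum; apply: ler_sum => i _; exact: cell_ge.
Qed.

Lemma admissible_le n (t : r.-tuple 'I_n) (z : r.-tuple mR) i :
  (0 < n)%N -> admissible gamma delta t -> cell t z ->
  (tnth z i : R) <= delta.
Proof.
move=> n0 /andP[_ /forallP/(_ i)/andP[_ h]] tz.
rewrite -(@ler_pM2l _ n%:R) ?ltr0n// [X in _ <= X]mulrC.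
exact: le_trans (cell_ge i tz) h.
Qed.

Lemma admissible_gt n (t : r.-tuple 'I_n) (z : r.-tuple mR) i :
  (0 < n)%N -> admissible gamma delta t -> cell t z ->
  gamma < (tnth z i : R) + n%:R^-1.
Proof.
move=> n0 /andP[_ /forallP/(_ i)/andP[h _]] tz.
rewrite -(@ltr_pM2l _ n%:R) ?ltr0n// mulrDr mulfV ?pnatr_eq0 -?lt0n//.
by rewrite mulrC; exact: le_lt_trans h (cell_lt i tz).
Qed.

(** The margin [n^-1] leaves room for rounding each coordinate up to a multiple
    of [n^-1]. *)
Lemma ex_admissible n (z : r.-tuple mR) : (0 < n)%N ->
  (forall i, gamma < (tnth z i : R)) ->
  (forall i, (tnth z i : R) + n%:R^-1 < delta) ->
  \sum_(i < r) ((tnth z i : R) + n%:R^-1) < 1 ->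
  exists2 t : r.-tuple 'I_n, admissible gamma delta t & cell t z.
Proof.
move=> n0 gz zd z1; have n0R : 0 < n%:R :> R by rewrite ltr0n.
have nz0 i : 0 < n%:R * (tnth z i : R).
  by rewrite mulr_gt0//; exact: le_lt_trans hgamma (gz i).
pose k i := sval (cid (ex_unit_cell (nz0 i))).
have kP i : (k i)%:R < n%:R * (tnth z i : R) <= (k i).+1%:R.
  by rewrite /k; case: cid.
have kd i : (k i).+1%:R <= n%:R * ((tnth z i : R) + n%:R^-1).
  rewrite mulrDr mulfV ?gt_eqF// -natr1 lerD2r.
  by apply: ltW; case/andP: (kP i).
have kn i : (k i < n)%N.
  rewrite -(ler_nat R); apply: le_trans (kd i) _.
  by rewrite -[leRHS]mulr1 ler_pM2l// (le_trans (ltW (zd i))).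
exists [tuple Ordinal (kn i) | i < r];
  last by move=> i; rewrite tnth_mktuple; exact: kP.
apply/andP; split.
  rewrite -(ler_nat R) natr_sum.
  apply: (@le_trans _ _ (\sum_(i < r) n%:R * ((tnth z i : R) + n%:R^-1))).
    by apply: ler_sum => i _; rewrite tnth_mktuple; exact: kd.
  by rewrite -mulr_sumr -[leRHS]mulr1 ler_pM2l// ltW.
apply/forallP => i; rewrite tnth_mktuple /=; apply/andP; split.
  have /andP[_] := kP i; apply: le_trans.
  by rewrite mulrC ler_pM2l// ltW.
by apply: le_trans (kd i) _; rewrite mulrC ler_pM2r// ltW.
Qed.

(** For large [n] the value of [step n] at [z] lies between the integrand at
    [z] shifted by [n^-1] in every coordinate and the integrand at [z]. *)
Lemma step_cvg_interior (z : r.-tuple mR) :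
  (forall i, gamma < (tnth z i : R) < delta) ->
  \sum_(i < r) (tnth z i : R) < 1 ->
  step n z @[n --> \oo] --> (\prod_(i < r) (tnth z i : R))^-1.
Proof.
move=> gzd z1.
have cvgz i : (tnth z i : R) + (n%:R^-1 : R) @[n --> \oo] --> (tnth z i : R).
  rewrite -[X in _ --> X]addr0; apply: cvgD; first exact: cvg_cst.
  exact: cvg_invn.
apply: (squeeze_cvgr (f := fun n => \prod_(i < r) ((tnth z i : R) + n%:R^-1)^-1)
                     (h := fun=> (\prod_(i < r) (tnth z i : R))^-1)).
- have lt_delta : \forall n \near \oo,
      forall i, (tnth z i : R) + n%:R^-1 < delta.
    apply: filter_forall => i; apply: cvgr_lt (cvgz i) _ _.
    by case/andP: (gzd i).
  have lt1 : \forall n \near \oo, \sum_(i < r) ((tnth z i : R) + n%:R^-1) < 1.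
    apply: cvgr_lt z1; apply: cvg_big => [|i _]; last exact: cvgz.
    exact: add_continuous.
  near=> n.
  have n0 : (0 < n)%N by near: n; exists 1%N.
  have [|||t at_ tz] := @ex_admissible n z n0.
  - by move=> i; case/andP: (gzd i).
  - by near: n.
  - by near: n.
  by rewrite (stepE at_ tz) le_weight//= weight_le.
- rewrite -prodfV; apply: cvg_big => [|i _]; first exact: mul_continuous.
  apply: cvgV (cvgz i); rewrite gt_eqF//.
  by apply: le_lt_trans hgamma _; case/andP: (gzd i).
- exact: cvg_cst.
Unshelve. all: by end_near. Qed.

(** Every point of an admissible cell satisfies the constraints up to an error
    of [n^-1], so that a point violating one strictly lies eventually in no
    admissible cell. *)
Lemma step_cvg_exterior (z : r.-tuple mR) :
  (exists i, (tnth z i : R) < gamma \/ delta < (tnth z i : R)) \/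
  1 < \sum_(i < r) (tnth z i : R) ->
  step n z @[n --> \oo] --> (0 : R).
Proof.
move=> ext; apply: cvg_near_cst.
have lt_gamma : \forall n \near \oo,
    forall i, (tnth z i : R) < gamma -> (tnth z i : R) + n%:R^-1 < gamma.
  apply: filter_forall => i; apply: filter_imply => zi.
  apply: cvgr_lt zi; rewrite -[X in _ --> X]addr0; apply: cvgD.
    exact: cvg_cst.
  exact: cvg_invn.
near=> n.
have n0 : (0 < n)%N by near: n; exists 1%N.
have [//|[t [at_ tz _]]] := stepP gamma delta n z.
case: ext => [[i [zi|zi]]|].
- have /(_ i zi) : forall i, (tnth z i : R) < gamma ->
    (tnth z i : R) + n%:R^-1 < gamma by near: n.
  by rewrite ltNge ltW// (admissible_gt i n0 at_ tz).
- by rewrite ltNge (admissible_le i n0 at_ tz) in zi.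
- by rewrite ltNge (admissible_sum n0 at_ tz).
Unshelve. all: by end_near. Qed.

Lemma step_cvg_ae : (0 < r)%N ->
  {ae mu, forall z, (step n z)%:E @[n --> \oo] --> (integrand \_ region) z}.
Proof.
move=> r0.
have ae_gamma : {ae mu, forall z, forall i, (tnth z i : R) != gamma}.
  by apply: filter_forall => i; exact: ae_coord_neq.
have ae_delta : {ae mu, forall z, forall i, (tnth z i : R) != delta}.
  by apply: filter_forall => i; exact: ae_coord_neq.
apply: (@filterS3 _ (almost_everywhere mu) _ _ _ _ _ _ ae_gamma ae_delta
  (ae_sum_neq 1 r0)) => z zg zd z1.
rewrite patchE; case: ifPn => [/set_mem [s1 gzd]|zr].
  apply: cvg_EFin; first exact: nearW.
  apply: step_cvg_interior => [i|]; last by rewrite lt_neqAle z1.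
  by have /andP[? ?] := gzd i; rewrite !lt_neqAle eq_sym zg zd; apply/andP.
apply: cvg_EFin; first exact: nearW.
apply: step_cvg_exterior.
have [s1|] := leP (\sum_(i < r) (tnth z i : R)) 1; last by right.
left; apply: contrapT => no; move/negP: zr; apply; apply/mem_set; split => // i.
by apply/andP; split; rewrite leNgt; apply/negP => h; apply: no; exists i;
  [left|right].
Qed.

End Region.
Arguments integrand {R r} z.

(** * Convergence of the integrals *)

Section Integral.
Variables (R : realType) (r : nat) (gamma delta : R).
Hypotheses (hgamma : 0 <= gamma) (hdelta : delta <= 1) (r0 : (0 < r)%N).
Local Notation mR := (measurableTypeR R).
Local Notation mu := (lebesgue_tuple R r).
Local Notation step := (step gamma delta).
Local Notation region := (@region R r gamma delta).

Let step_meas n : measurable_fun setT (fun z : r.-tuple mR => (step n z)%:E).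
Proof. by apply/measurable_EFinP; exact: measurable_step. Qed.

(** For [gamma > 0] the lengths are at least [gamma n], which bounds the
    step functions by [gamma^-r] on the unit cube. The region itself could not
    serve as common support: near its boundary [z_i = gamma], admissible cells
    may stick out of it. *)
Lemma integral_step_cvg_pos : 0 < gamma ->
  (\int[mu]_z (step n z)%:E)%E @[n --> \oo] -->
  (\int[mu]_z (integrand \_ region) z)%E.
Proof.
move=> g0.
pose B : set (r.-tuple mR) := [set z | forall i, [set` `[0%R, 1%R]] (tnth z i)].
have mB : measurable B.
  apply: (measurable_box (A := fun=> [set` `[0%R, 1%R]])) => i.
  exact: measurable_itv.
pose g (z : r.-tuple mR) : \bar R := ((gamma^-1 ^+ r)%:E * (\1_B z)%:E)%E.
have Bfin : (mu B < +oo)%E.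
  have -> : mu B =
      (\prod_(i < r) lebesgue_measure ([set` `[0%R, 1%R]] : set mR))%E.
    by apply: (lebesgue_tuple_box (A := fun=> [set` `[0%R, 1%R]])) => i;
      exact: measurable_itv.
  rewrite big1 ?ltry// => i _; rewrite lebesgue_measure_itv /= lte_fin ltr01.
  by rewrite oppr0 adde0.
have ig : mu.-integrable setT g.
  apply: integrableZl => //; apply/integrableP; split.
    by apply/measurable_EFinP; exact: measurable_indic.
  rewrite (eq_integral (fun z => (\1_B z)%:E)); last first.
    by move=> z _; rewrite gee0_abs// lee_fin.
  by rewrite integral_indic// setIT.
have step_le_g z n : (`|(step n z)%:E| <= g z)%E.
  rewrite gee0_abs; last by rewrite lee_fin step_ge0.
  rewrite /g -EFinM lee_fin.
  have [->|[t [at_ tz ->]]] := stepP gamma delta n z.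
    by rewrite mulr_ge0// exprn_ge0// invr_ge0.
  have n0 := tuple_ord_gt0 t r0.
  rewrite indicE mem_set; last first.
    move=> i; rewrite /= in_itv /= ltW ?(cell_pos i tz)//=.
    exact: le_trans (admissible_le i n0 at_ tz) hdelta.
  rewrite mulr1 -[X in _ ^+ X]card_ord -prodr_const.
  apply: ler_prod => i _; rewrite divr_ge0//=.
  have /andP[_ /forallP/(_ i)/andP[h _]] := at_.
  by rewrite ler_pdivrMr ?ltr0n// mulrC ler_pdivlMr// mulrC.
have step_le_g_ae : {ae mu, forall z n, setT z -> (`|(step n z)%:E| <= g z)%E}.
  apply: aeW => z n _; exact: step_le_g.
have cvg_ae : {ae mu, forall z, setT z ->
    (step n z)%:E @[n --> \oo] --> (integrand \_ region) z}.
  by apply: filterS (step_cvg_ae hgamma hdelta r0) => z h _.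
by have [] := dominated_convergence measurableT step_meas
  (measurable_integrand delta hgamma) cvg_ae ig step_le_g_ae.
Qed.

(** For [gamma = 0] all cells lie in [z_i > 0], so that no admissible cell
    sticks out of the region and [step n] is below the restricted integrand. *)
Lemma integral_step_cvg_zero : gamma = 0 ->
  (\int[mu]_z (step n z)%:E)%E @[n --> \oo] -->
  (\int[mu]_z (integrand \_ region) z)%E.
Proof.
move=> g0; apply: sandwich_cvg_einf => [n|].
  apply: ge0_le_integral => //.
  - by move=> z _; rewrite lee_fin step_ge0.
  - exact: measurable_integrand.
  move=> z _; have [->|[t [at_ tz ->]]] := stepP gamma delta n z.
    exact: restrict_integrand_ge0.
  have n0 := tuple_ord_gt0 t r0.
  rewrite patchE mem_set; first by rewrite lee_fin weight_le.
  split; first exact: (admissible_sum n0 at_ tz).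
  move=> i; rewrite g0 (ltW (cell_pos i tz)).
  exact: (admissible_le i n0 at_ tz).
have step0 n (z : r.-tuple mR) : setT z -> (0 <= (step n z)%:E)%E.
  by rewrite lee_fin step_ge0.
apply: le_trans (fatou mu measurableT step_meas step0).
rewrite le_eqVlt; apply/orP; left; apply/eqP; apply: ae_eq_integral => //.
- exact: measurable_integrand.
- rewrite (_ : (fun _ => _) = -%E \o (fun z : r.-tuple mR =>
    limn_esup (fun n => - (step n z)%:E))%E); last first.
    by apply/funext => z /=; rewrite -[RHS]limn_einfN; congr limn_einf;
      apply/funext => n /=; rewrite opprK.
  apply: measurableT_comp => //; apply: measurable_fun_limn_esup => n.
  exact: measurableT_comp.
apply: filterS (step_cvg_ae hgamma hdelta r0) => z cz _.
by rewrite (cvg_limn_einf_sup cz).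
Qed.

Lemma integral_step_cvg :
  (\int[mu]_z (step n z)%:E)%E @[n --> \oo] -->
  (\int[mu]_z (integrand \_ region) z)%E.
Proof.
have := hgamma; rewrite le_eqVlt => /predU1P[/esym|].
  exact: integral_step_cvg_zero.
exact: integral_step_cvg_pos.
Qed.

End Integral.

Lemma unif_expectation_ffact_cycles (R : realType) (gamma delta : R)
    (r n : nat) :
  unif_expectation (fun s : {perm 'I_n} =>
     (num_cycles_between (gamma * n%:R) (delta * n%:R) s ^_ r)%:R : R) =
  composition_sum R (fun k => gamma * n%:R <= k%:R <= delta * n%:R) r n.
Proof.
rewrite /unif_expectation /num_cycles_between.
rewrite (sum_ffact_cycles _ R
  (fun k : nat => gamma * n%:R <= k%:R <= delta * n%:R)).
rewrite card_ord mulrAC mulfV ?mul1r//.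
by rewrite pnatr_eq0 -lt0n; apply/card_gt0P; exists 1%g.
Qed.

Theorem theorem3 (R : realType) (gamma delta : R) (r : nat)
    (hgamma : 0 <= gamma) (hgd : gamma < delta) (hdelta : delta <= 1)
    (hr : (0 < r)%N) :
  (unif_expectation (fun s : {perm 'I_n} =>
     (num_cycles_between (gamma * n%:R) (delta * n%:R) s ^_ r)%:R : R))%:E
    @[n --> \oo]
  --> (\int[lebesgue_tuple R r]_(z in
         [set z | (\sum_(i < r) (tnth z i : R) <= 1)%R /\
                  forall i, (gamma <= (tnth z i : R) <= delta)%R])
        ((\prod_(i < r) (tnth z i : R))^-1)%:E)%E.
Proof.
rewrite integral_mkcond.
apply: cvg_trans (integral_step_cvg hgamma hdelta hr).
apply: near_eq_cvg; near=> n.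
rewrite unif_expectation_ffact_cycles integral_step//.
by near: n; exists 1%N.
Unshelve. all: by end_near. Qed.
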